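(* Let $G$ be a countable, abelian, discrete group and let $X\in VN(G)$. If there exists a minimal idempotent $\omega\in\beta G$ such that $X\in\mathcal{U}(\omega)$, then $X\in\mathcal{U}(\alpha)$ for every $\alpha\in\beta G$.
   Context: $\{e_g\}_{g\in G}$ is the canonical orthonormal basis of $\ell^2(G)$, $U_g$ is the left regular representation, $U_ge_h=e_{gh}$, and $VN(G)\subseteq B(\ell^2(G))$ is the von Neumann algebra generated by $\{U_g:g\in G\}$. $\mathcal{D}=\{M_f:f\in\ell^\infty(G)\}\subseteq B(\ell^2(G))$ is the algebra of diagonal (multiplication) operators, identified with $\ell^\infty(G)\equiv C(\beta G)$, where $\beta G$ is the Stone-Cech compactification of $G$; the continuous extension of $f$ to $\beta G$ is again denoted $f$. For $\omega\in\beta G$, $s_\omega:\mathcal{D}\to\mathbb{C}$ is the pure state $s_\omega(M_f)=f(\omega)$, and $E_0:B(\ell^2(G))\to\mathcal{D}$ is the canonical projection (conditional expectation) onto the diagonal. The uniqueness set of $\omega$ is $$\mathcal{U}(\omega)=\{X\in B(\ell^2(G)):s(X)=s_\omega(E_0(X))\text{ for every state } s \text{ on } B(\ell^2(G)) \text{ extending } s_\omega\}.$$ Left multiplication $g_1\mapsto gg_1$ extends to a homeomorphism of $\beta G$, written $\omega\mapsto g\cdot\omega$. For $\omega\in\beta G$, $\rho_\omega:\beta G\to\beta G$ is the unique continuous map with $\rho_\omega(g)=g\cdot\omega$ for $g\in G$, and $\alpha\cdot\omega:=\rho_\omega(\alpha)$ defines an associative product on $\beta G$ (making it a compact right topological semigroup).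 A point $\omega$ is idempotent if $\omega\cdot\omega=\omega$; an idempotent $\omega$ is minimal if the left ideal $\{\alpha\cdot\omega:\alpha\in\beta G\}$ is a minimal left ideal of $\beta G$. *)

(* Defs.v *)
From HB Require Import structures.
From mathcomp Require Import all_boot all_order all_algebra finmap complex.
From mathcomp Require Import all_classical all_reals all_analysis.
From mathcomp Require Import showcase.summability.
From mathcomp Require Import ring.

Set Implicit Arguments.
Unset Strict Implicit.
Unset Printing Implicit Defensive.
Import Order.TTheory GRing.Theory Num.Theory.
Import numFieldNormedType.Exports.
Import Normc.

Local Open Scope classical_set_scope.
Local Open Scope ring_scope.

(* The norm topology on R[i]; the library only declares it for abstract
   numeric fields. *)
#[warnings="-redundant-canonical-projection"]
HB.instance Definition _ (R : realType) := NormedModule.copy R[i] R[i]^o.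

Section ell2.
Context {R : realType} {T : choiceType}.
Implicit Types (x y : T -> R[i]) (t : T).

Definition sqsum x : \bar R :=
  (\esum_(t in [set: T]) ((normc (x t) ^+ 2)%:E))%E.

Definition ell2_pred : {pred T -> R[i]} := fun x => `[< (sqsum x < +oo)%E >].

Lemma sqsum_ge0 x : (0 <= sqsum x)%E.
Proof. by apply: esum_ge0 => t _; rewrite lee_fin sqr_ge0. Qed.

Lemma normc_ge0 (z : R[i]) : 0 <= normc z.
Proof. by case: z => a b /=; rewrite sqrtr_ge0. Qed.

Lemma le_sqsumZ (K : R) x y : 0 <= K ->
  (forall t, normc (y t) <= K * normc (x t)) ->
  (sqsum y <= (K ^+ 2)%:E * sqsum x)%E.
Proof.
move=> K0 yx; apply: ge_ereal_sup => _ [A [finA AT] <-].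
apply: (@le_trans _ _ ((K ^+ 2)%:E * \sum_(t \in A) (normc (x t) ^+ 2)%:E)%E).
  rewrite ge0_mule_fsumr; last by move=> t; rewrite lee_fin sqr_ge0.
  apply: lee_fsum => // t _; rewrite lee_fin -exprMn.
  by rewrite lerXn2r ?nnegrE ?mulr_ge0 ?normc_ge0.
apply: lee_wpmul2l; first by rewrite lee_fin sqr_ge0.
by apply: ereal_sup_ubound; exists A.
Qed.

Lemma le_sqsumD x y : (sqsum (x + y)%R <= 2%:E * (sqsum x + sqsum y))%E.
Proof.
rewrite -esumD; try by move=> t _; rewrite lee_fin sqr_ge0.
apply: ge_ereal_sup => _ [A [finA AT] <-].
apply: (@le_trans _ _ (2%:E * \sum_(t \in A)
   ((normc (x t) ^+ 2)%:E + (normc (y t) ^+ 2)%:E))%E); last first.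
  by apply: lee_wpmul2l => //; apply: ereal_sup_ubound; exists A.
rewrite ge0_mule_fsumr; last by move=> t; rewrite -EFinD lee_fin addr_ge0 ?sqr_ge0.
apply: lee_fsum => // t _; rewrite -EFinD -EFinM lee_fin.
apply: (@le_trans _ _ ((normc (x t) + normc (y t)) ^+ 2)).
  by rewrite lerXn2r ?nnegrE ?addr_ge0 ?normc_ge0 ?le_normcD.
rewrite -subr_ge0.
suff -> : 2 * (normc (x t) ^+ 2 + normc (y t) ^+ 2) -
  (normc (x t) + normc (y t)) ^+ 2 = (normc (x t) - normc (y t)) ^+ 2.
  exact: sqr_ge0.
by rewrite sqrrD sqrrB mulr_natl mulr2n; ring.
Qed.

Lemma ell2_submod_closed : submod_closed ell2_pred.
Proof.
split.
  apply/asboolP; rewrite /sqsum esum1 ?ltry// => t _.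
  by rewrite normc0 expr0n.
move=> a x y /asboolP lx /asboolP ly; apply/asboolP.
apply: (le_lt_trans (le_sqsumD _ _)); apply: lte_mul_pinfty => //.
apply: lte_add_pinfty => //.
have lax : (sqsum (a *: x)%R <= (normc a ^+ 2)%:E * sqsum x)%E.
  by apply: le_sqsumZ => [|t]; rewrite ?normc_ge0// -normcM.
apply: (le_lt_trans lax); apply: lte_mul_pinfty => //.
by rewrite lee_fin sqr_ge0.
Qed.

HB.instance Definition _ :=
  GRing.isSubmodClosed.Build R[i] (T -> R[i]) ell2_pred ell2_submod_closed.

End ell2.

Record ell2 (R : realType) (T : choiceType) : Type := Ell2 {
  ell2_fun :> T -> R[i];
  ell2_funP : ell2_pred ell2_fun
}.

HB.instance Definition _ (R : realType) (T : choiceType) :=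
  [isSub for @ell2_fun R T].
HB.instance Definition _ (R : realType) (T : choiceType) :=
  [Choice of ell2 R T by <:].
HB.instance Definition _ (R : realType) (T : choiceType) :=
  [SubChoice_isSubLmodule of ell2 R T by <:].

#[local] Existing Instance summability.totally_filter.

Section ell2_theory.
Context {R : realType} {T : choiceType}.
Local Notation H := (ell2 R T).
Implicit Types (x y : H) (t : T).

Definition norm2 x : R := Num.sqrt (fine (sqsum x)).

(* <x, y> = sum of x t * conj (y t), the unordered sum being the limit of the
   finite partial sums; linear in the first variable. *)
Definition inner x y : R[i] := summability.sum (fun t => x t * (y t)^*).

Lemma ell2_linE (a : R[i]) x y t : (a *: x + y) t = a * x t + y t.
Proof. by []. Qed.

Lemma ell2P x : (sqsum x < +oo)%E.
Proof. by have /asboolP := ell2_funP x. Qed.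

Lemma sqsum_fin x : sqsum x \is a fin_num.
Proof. by rewrite ge0_fin_numE ?sqsum_ge0// ell2P. Qed.

Lemma norm2_ge0 x : 0 <= norm2 x.
Proof. exact: sqrtr_ge0. Qed.

Lemma sqr_norm2 x : ((norm2 x ^+ 2)%:E = sqsum x)%E.
Proof. by rewrite sqr_sqrtr ?fine_ge0 ?sqsum_ge0// fineK// sqsum_fin. Qed.

Lemma le_norm2 (K : R) x y : 0 <= K ->
  (sqsum y <= (K ^+ 2)%:E * sqsum x)%E -> norm2 y <= K * norm2 x.
Proof.
move=> K0; rewrite -!sqr_norm2 -EFinM lee_fin -exprMn.
by rewrite ler_sqr ?nnegrE ?mulr_ge0 ?norm2_ge0.
Qed.

Lemma normc_le_norm2 x t : normc (x t) <= norm2 x.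
Proof.
rewrite -ler_sqr ?nnegrE ?normc_ge0 ?norm2_ge0//.
rewrite -lee_fin sqr_norm2; apply: esum_ge; exists [set t]; first by split.
by rewrite fsbig_set1.
Qed.

Lemma norm2D x y : norm2 (x + y) <= 2 * (norm2 x + norm2 y).
Proof.
rewrite -ler_sqr ?nnegrE ?mulr_ge0 ?addr_ge0 ?norm2_ge0//.
rewrite -lee_fin sqr_norm2.
apply: (le_trans (le_sqsumD _ _)).
rewrite -!sqr_norm2 -EFinD -EFinM lee_fin -subr_ge0.
have -> : (2 * (norm2 x + norm2 y)) ^+ 2 - 2 * (norm2 x ^+ 2 + norm2 y ^+ 2) =
  2 * norm2 x ^+ 2 + 2 * norm2 y ^+ 2 + 8 * (norm2 x * norm2 y) by ring.
by rewrite !addr_ge0 ?mulr_ge0 ?norm2_ge0.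
Qed.

Lemma norm2Z (a : R[i]) x : norm2 (a *: x) <= normc a * norm2 x.
Proof.
apply: le_norm2; first exact: normc_ge0.
by apply: le_sqsumZ => [|t]; rewrite ?normc_ge0// -normcM.
Qed.

Definition delta_fun t : T -> R[i] := fun u => (u == t)%:R.

Lemma sqsum_delta t : (sqsum (delta_fun t) = 1)%E.
Proof.
rewrite /sqsum (esumID [set t])/=; last first.
  by move=> u _; rewrite lee_fin sqr_ge0.
rewrite setTI esum_set1 ?lee_fin ?sqr_ge0// esum1 ?adde0.
  by rewrite /delta_fun eqxx normc1 expr1n.
by move=> u [_ /= /eqP ut]; rewrite /delta_fun (negbTE ut) normc0 expr0n.
Qed.

Lemma delta_subproof t : ell2_pred (delta_fun t).
Proof. by apply/asboolP; rewrite sqsum_delta ltry. Qed.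

Definition delta t : H := Ell2 (delta_subproof t).

Lemma inner_delta x t : inner x (delta t) = x t.
Proof.
rewrite /inner /summability.sum; apply/cvg_lim; first exact: norm_hausdorff.
apply: cvg_near_cst; exists [fset t]%fset => // A /= tA.
rewrite /partial_sum (bigD1 [` fsubsetP tA t (fset11 t)]%fset)//=.
rewrite /delta_fun eqxx conjC1 mulr1 big1 ?addr0// => u ut.
by rewrite -val_eqE/= in ut; rewrite (negbTE ut) conjC0 mulr0.
Qed.

End ell2_theory.

Section bounded_operators.
Context {R : realType} {T : choiceType}.
Local Notation H := (ell2 R T).

Definition bop_pred : {pred H -> H} := fun X =>
  `[< linear X /\ exists M : R, forall x, norm2 (X x) <= M * norm2 x >].

Lemma bop_bound (X : H -> H) : bop_pred X ->
  exists2 M : R, 0 <= M & forall x, norm2 (X x) <= M * norm2 x.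
Proof.
move=> /asboolP[_ [M XM]]; exists `|M| => // x.
by rewrite (le_trans (XM x))// ler_wpM2r ?norm2_ge0 ?ler_norm.
Qed.

Lemma bop_submod_closed : submod_closed bop_pred.
Proof.
split.
  apply/asboolP; split=> [a x y|]; first by rewrite scaler0 addr0.
  exists 0 => x; rewrite mul0r -[X in X <= _]/(norm2 0).
  by rewrite -(scale0r (0 : H)) (le_trans (norm2Z _ _))// normc0 mul0r.
move=> a X Y bX bY.
have [M M0 XM] := bop_bound bX; have [N N0 YN] := bop_bound bY.
move: bX bY => /asboolP[lX _] /asboolP[lY _].
apply/asboolP; split=> [b x y|].
  rewrite -![(a *: X + Y) _]/(a *: X _ + Y _) lX lY !scalerDr !scalerA.
  by rewrite (mulrC b a) addrACA.
exists (2 * (normc a * M + N)) => x.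
rewrite -[(a *: X + Y) _]/(a *: X _ + Y _) (le_trans (norm2D _ _))//.
rewrite -mulrA ler_wpM2l// mulrDl lerD//.
by rewrite (le_trans (norm2Z _ _))// -mulrA ler_wpM2l ?normc_ge0.
Qed.

HB.instance Definition _ :=
  GRing.isSubmodClosed.Build R[i] (H -> H) bop_pred bop_submod_closed.

End bounded_operators.

Record bop (R : realType) (T : choiceType) : Type := Bop {
  bop_fun :> ell2 R T -> ell2 R T;
  bop_funP : bop_pred bop_fun
}.

HB.instance Definition _ (R : realType) (T : choiceType) :=
  [isSub for @bop_fun R T].
HB.instance Definition _ (R : realType) (T : choiceType) :=
  [Choice of bop R T by <:].
HB.instance Definition _ (R : realType) (T : choiceType) :=
  [SubChoice_isSubLmodule of bop R T by <:].

Record linfty (R : realType) (T : Type) : Type := Linfty {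
  linfty_fun :> T -> R[i];
  linfty_funP : exists M : R, forall t, normc (linfty_fun t) <= M
}.

Section operators.
Context {R : realType} {T : choiceType}.
Local Notation H := (ell2 R T).
Local Notation B := (bop R T).
Implicit Types X Y : B.

Lemma opid_subproof : bop_pred (@idfun H).
Proof. by apply/asboolP; split=> //; exists 1 => x; rewrite mul1r. Qed.

Definition opid : B := Bop opid_subproof.

Lemma opcomp_subproof X Y : bop_pred (X \o Y).
Proof.
have [M M0 XM] := bop_bound (bop_funP X).
have [N N0 YN] := bop_bound (bop_funP Y).
have /asboolP[lX _] := bop_funP X; have /asboolP[lY _] := bop_funP Y.
apply/asboolP; split=> [a x y|]; first by rewrite /= lY lX.
exists (M * N) => x; rewrite (le_trans (XM _))// -mulrA.
by rewrite ler_wpM2l.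
Qed.

Definition opcomp X Y : B := Bop (opcomp_subproof X Y).

Definition is_adjoint X Y := forall x y, inner (X x) y = inner x (Y y).

Definition positive_op X := forall x, 0 <= inner (X x) x.

Definition is_state (s : B -> R[i]) :=
  [/\ scalar s, (forall X, positive_op X -> 0 <= s X) & s opid = 1].

(* The weak operator topology is the initial topology of this map. *)
Definition matrix_coefs X : {ptws H * H -> R[i]} :=
  fun p => inner (X p.1) p.2.

Definition wot_closed (M : set B) :=
  closed (M : set (initial_topology matrix_coefs)).

(* Unital *-subalgebras of B(l^2) closed in the weak operator topology. *)
Record von_neumann_algebra (M : set B) : Prop := {
  vna_id : M opid;
  vna_lin : forall (a : R[i]) X Y, M X -> M Y -> M (a *: X + Y);
  vna_comp : forall X Y, M X -> M Y -> M (opcomp X Y);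
  vna_adj : forall X Y, M X -> is_adjoint X Y -> M Y;
  vna_closed : wot_closed M
}.

Section mulop.
Variable f : linfty R T.

Lemma mulop_sqsum : exists2 K : R, 0 <= K & forall x : H,
  (sqsum (fun t => f t * x t)%R <= (K ^+ 2)%:E * sqsum x)%E.
Proof.
have [K fK] := linfty_funP f; exists `|K| => // x.
apply: le_sqsumZ => // t; rewrite normcM ler_wpM2r ?normc_ge0//.
by rewrite (le_trans (fK t))// ler_norm.
Qed.

Lemma mulop_ell2 (x : H) : ell2_pred (fun t => f t * x t).
Proof.
have [K K0 fK] := mulop_sqsum; apply/asboolP/(le_lt_trans (fK x)).
by apply: lte_mul_pinfty; rewrite ?lee_fin ?sqr_ge0 ?ell2P.
Qed.

Lemma mulop_subproof : bop_pred (fun x : H => Ell2 (mulop_ell2 x)).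
Proof.
apply/asboolP; split=> [a x y|].
  apply/val_inj/funext => t.
  rewrite -[LHS]/(f t * (a * x t + y t)) -[RHS]/(a * (f t * x t) + f t * y t).
  by rewrite mulrDr mulrCA.
have [K K0 fK] := mulop_sqsum; exists K => x.
by apply: le_norm2 => //; exact: fK.
Qed.

Definition mulop : B := Bop mulop_subproof.

End mulop.

Lemma diag_bounded X :
  exists M : R, forall t, normc (inner (X (delta t)) (delta t)) <= M.
Proof.
have [M M0 XM] := bop_bound (bop_funP X); exists M => t.
rewrite inner_delta (le_trans (normc_le_norm2 _ _))// (le_trans (XM _))//.
suff -> : norm2 (delta t : H) = 1 by rewrite mulr1.
by rewrite /norm2 sqsum_delta sqrtr1.
Qed.

(* The conditional expectation onto the diagonal; the diagonal algebra is
   identified with l^oo through f |-> mulop f. *)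
Definition E0 X : linfty R T := Linfty (diag_bounded X).

End operators.

Section translations.
Context {R : realType} {G : zmodType}.
Local Notation H := (ell2 R G).

Lemma translate_sqsum (g : G) (x : H) :
  sqsum (fun h => x (h - g)) = sqsum x.
Proof.
rewrite /sqsum [RHS](@reindex_esum _ _ _ setT setT (fun h => h - g))//.
split=> //; first by move=> h k _ _; apply: addIr.
by move=> h _; exists (h + g) => //; rewrite addrK.
Qed.

Lemma translate_ell2 (g : G) (x : H) : ell2_pred (fun h => x (h - g)).
Proof. by apply/asboolP; rewrite translate_sqsum ell2P. Qed.

Lemma translate_subproof (g : G) :
  bop_pred (fun x : H => Ell2 (translate_ell2 g x)).
Proof.
apply/asboolP; split=> [a x y|]; first exact/val_inj/funext.
by exists 1 => x; rewrite mul1r /norm2 translate_sqsum.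
Qed.

Definition translation (g : G) : bop R G := Bop (translate_subproof g).

Lemma translation_delta (g h : G) : translation g (delta h) = delta (g + h).
Proof.
apply/val_inj/funext => k.
by rewrite /= /delta_fun subr_eq addrC.
Qed.

(* The von Neumann algebra generated by the translations. *)
Definition VN : set (bop R G) :=
  smallest von_neumann_algebra (range translation).

End translations.
Arguments VN R G : clear implicits.

(* The Stone-Cech compactification of the discrete set G, as the space of its
   ultrafilters. *)
Record beta (G : Type) : Type := Beta {
  beta_filter : set_system G;
  beta_ultra : UltraFilter beta_filter
}.

#[global] Existing Instance beta_ultra.

HB.instance Definition _ (G : Type) := gen_eqMixin (beta G).
HB.instance Definition _ (G : Type) := gen_choiceMixin (beta G).

Section beta_topology.
Context {G : Type}.
Implicit Types w : beta G.

Lemma beta_inj w w' : beta_filter w = beta_filter w' -> w = w'.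
Proof.
case: w w' => [F UF] [F' UF'] /= FF'; case: _ / FF' UF' => UF'.
by congr Beta; exact: Prop_irrelevance.
Qed.

Definition beta_base (A : set G) : set (beta G) := [set w : beta G | beta_filter w A].

Lemma beta_base_cover : \bigcup_(A in [set: set G]) beta_base A = setT.
Proof. by apply/seteqP; split=> // w _; exists setT => //; exact: filterT. Qed.

Lemma beta_base_join (A A' : set G) w : [set: set G] A -> [set: set G] A' ->
  beta_base A w -> beta_base A' w ->
  exists A'', [/\ [set: set G] A'', beta_base A'' w &
                  beta_base A'' `<=` beta_base A `&` beta_base A'].
Proof.
move=> _ _ wA wA'; exists (A `&` A'); split=> //; first exact: filterI.
by move=> w'; rewrite /beta_base /= => w'AA'; split;
  apply: filterS w'AA' => ? [].
Qed.

HB.instance Definition _ :=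
  isBaseTopological.Build (beta G) beta_base_cover beta_base_join.

Definition principal (g : G) : beta G := Beta (principal_filter_ultra g).

(* The value at w of the continuous extension of f, as the limit of f along
   the ultrafilter w. *)
Definition beta_ext (K : ptopologicalType) (f : G -> K) w : K := lim (f @ beta_filter w).

Lemma beta_base_open A : open (beta_base A).
Proof. by exists [set A] => //; rewrite bigcup_set1. Qed.

Lemma beta_ultraC w A : beta_base A w \/ beta_base (~` A) w.
Proof. exact: in_ultra_setVsetC. Qed.

Lemma beta_hausdorff : hausdorff_space (beta G).
Proof.
rewrite open_hausdorff => w w' /eqP ww'.
have [A wA w'A] : exists2 A, beta_base A w & beta_base (~` A) w'.
  apply: contrapT => wNw'; apply/ww'/beta_inj/esym/max_filter => A wA.
  have [//|w'A] := beta_ultraC w' A.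
  by exfalso; apply: wNw'; exists A.
exists (beta_base A, beta_base (~` A)) => /=; first by rewrite !in_setE.
split; [exact: beta_base_open|exact: beta_base_open|].
apply/eqP/seteqP; split=> // v [vA vA'].
by have /filter_ex[? []] : beta_filter v (A `&` ~` A) by exact: filterI.
Qed.

Lemma beta_compact : compact [set: beta G].
Proof.
rewrite compact_ultra => F UF _.
pose v := [set A | F (beta_base A)].
have PF : ProperFilter v.
  apply: Build_ProperFilter_ex.
    move=> A FA; have [w wA] := @filter_ex _ F _ _ FA.
    exact: (@filter_ex _ (beta_filter w) _ _ wA).
  split=> [|A A' vA vA'|A A' AA']; rewrite /v /=.
  - by apply: filterS filterT => w _; exact: filterT.
  - by apply: filterS (@filterI _ F _ _ _ vA vA') => w [? ?]; exact: filterI.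
  - by apply: filterS => w; exact: filterS.
have UV : UltraFilter v.
  split=> // W PW vW; apply/seteqP; split=> // A WA.
  have [//|nA] := in_ultra_setVsetC (beta_base A) UF.
  have : v (~` A).
    by apply: filterS nA => w nwA; have [|] := beta_ultraC w A.
  move=> /vW WnA; exfalso.
  by have /filter_ex[? []] : W (A `&` ~` A) by exact: filterI.
exists (Beta UV); split=> // U; rewrite nbhsE => -[V [[D _ <-] [A DA vA]] VU].
by apply: (@filterS _ F _ (beta_base A)) vA => w wA; apply: VU; exists A.
Qed.

Lemma principal_dense : dense (range principal).
Proof.
move=> U [w Uw] [D _ DU]; move: Uw; rewrite -DU => -[A DA wA].
have [g Ag] := @filter_ex _ (beta_filter w) _ _ wA; exists (principal g); split; last by exists g.
by exists A => //; apply/principal_filterP.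
Qed.

Lemma beta_ext_principal (K : ptopologicalType) (f : G -> K) g :
  hausdorff_space K -> beta_ext f (principal g) = f g.
Proof.
move=> hK; apply/cvg_lim => // U /nbhs_singleton Ufg.
exact/principal_filterP.
Qed.

Lemma beta_ext_continuous (K : ptopologicalType) (f : G -> K) :
  regular_space K -> (forall w, cvg (f @ beta_filter w)) -> continuous (beta_ext f).
Proof.
move=> rK cf w U /rK[V nV VU].
have wV : beta_filter w (f @^-1` V) by exact: cf.
have nw : nbhs w (beta_base (f @^-1` V)).
  by apply: open_nbhs_nbhs; split=> //; exact: beta_base_open.
apply: (@filterS _ (nbhs w) _ _ _ _ nw).
move=> w' w'V; apply: VU.
have cw' : f @ beta_filter w' --> beta_ext f w' by exact: cf.
have Pw' : ProperFilter (beta_filter w') := @ultra_proper _ _ (beta_ultra w').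
have fV : \forall g \near beta_filter w', closure V (f g).
  by apply: filterS w'V => g; exact: subset_closure.
exact: (closed_cvg (closure V) (@closed_closure _ V) fV _ cw').
Qed.

End beta_topology.

Lemma beta_fmap_ultra (G : Type) (U : Type) (w : beta G) (f : G -> U) :
  UltraFilter (f @ beta_filter w).
Proof.
split=> [|W PW fW]; first exact: fmap_proper_filter.
apply/seteqP; split=> // A WA.
have [//|nA] := beta_ultraC w (f @^-1` A).
exfalso; have WnA : W (~` A) by exact: fW.
by have /filter_ex[? []] : W (A `&` ~` A) by exact: filterI.
Qed.

Lemma beta_compact_cvg (G : Type) (K : ptopologicalType) (f : G -> K) w :
  compact [set: K] -> cvg (f @ beta_filter w).
Proof.
rewrite compact_ultra => /(_ (f @ beta_filter w) (beta_fmap_ultra w f)).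
by case=> [|l [_ fl]]; [exact: filterT|exact: cvgP fl].
Qed.

Section beta_linfty.
Context {R : realType} {G : Type}.

Lemma real_ultra_cvg (w : beta G) (f : G -> R) (M : R) :
  (forall g, `|f g| <= M) -> exists l : R, f @ beta_filter w --> l.
Proof.
move=> fM.
have := @segment_compact R (- M) M; rewrite compact_ultra.
case/(_ (f @ beta_filter w) (beta_fmap_ultra w f)) => [|l [_ fl]]; last by exists l.
by apply: (@filterS _ (beta_filter w) _ setT) filterT => g _ /=; rewrite in_itv/= -ler_norml.
Qed.

Lemma linfty_cvg (w : beta G) (f : linfty R G) :
  cvg (linfty_fun f @ beta_filter w).
Proof.
have [M fM] := linfty_funP f.
have [a fa] : exists a : R, (@complex.Re R) \o linfty_fun f @ beta_filter w --> a.
  apply: (@real_ultra_cvg _ _ M) => g; rewrite (le_trans _ (fM g))//=.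
  case: (f g) => x y /=; rewrite -(sqrtr_sqr x) ler_wsqrtr//.
  by rewrite lerDl sqr_ge0.
have [b fb] : exists b : R, (@complex.Im R) \o linfty_fun f @ beta_filter w --> b.
  apply: (@real_ultra_cvg _ _ M) => g; rewrite (le_trans _ (fM g))//=.
  case: (f g) => x y /=; rewrite -(sqrtr_sqr y) ler_wsqrtr//.
  by rewrite lerDr sqr_ge0.
apply/cvg_ex; exists (Complex a b); apply/cvgrPdist_le => /= e e0.
have [r er] : exists r : R, e = r%:C%C.
  by exists (complex.Re e); rewrite RRe_real// gtr0_real.
rewrite er in e0 *; rewrite ltcR in e0.
have r20 : 0 < r / 2 by rewrite divr_gt0.
move/cvgrPdist_le : fa => /(_ _ r20) fa.
move/cvgrPdist_le : fb => /(_ _ r20) fb.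
apply: filterS2 fa fb => g /=; case: (f g) => x y /= ax bby.
rewrite lecR (splitr r).
rewrite -[leLHS]/(normc (Complex (a - x) (b - y))).
have -> : Complex (a - x) (b - y) = Complex (a - x) 0 + Complex 0 (b - y).
  by rewrite -[RHS]/(Complex _ _) addr0 add0r.
rewrite (le_trans (le_normcD _ _))// lerD//=.
  by rewrite expr0n addr0 sqrtr_sqr.
by rewrite expr0n add0r sqrtr_sqr.
Qed.

End beta_linfty.

Section beta_semigroup.
Context {G : zmodType}.
Implicit Types w a : beta G.

HB.instance Definition _ := isPointed.Build (beta G) (principal 0).

Definition beta_act (g : G) : beta G -> beta G :=
  beta_ext (fun h => principal (g + h)).

Definition beta_rho w : beta G -> beta G := beta_ext (fun g => beta_act g w).

Definition beta_mul a w : beta G := beta_rho w a.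

Lemma beta_regular : regular_space (beta G).
Proof.
move=> w; apply: (@compact_regular _ w setT) => //.
- exact: beta_hausdorff.
- exact: beta_compact.
- exact: filterT.
Qed.

Lemma beta_act_principal g h : beta_act g (principal h) = principal (g + h).
Proof. by rewrite /beta_act beta_ext_principal//; exact: beta_hausdorff. Qed.

Lemma beta_act_continuous g : continuous (beta_act g).
Proof.
apply: beta_ext_continuous; first exact: beta_regular.
by move=> w; apply: beta_compact_cvg; exact: beta_compact.
Qed.

Lemma beta_rho_principal w g : beta_rho w (principal g) = beta_act g w.
Proof. by rewrite /beta_rho beta_ext_principal//; exact: beta_hausdorff. Qed.

Lemma beta_rho_continuous w : continuous (beta_rho w).
Proof.
apply: beta_ext_continuous; first exact: beta_regular.
by move=> a; apply: beta_compact_cvg; exact: beta_compact.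
Qed.

Definition idempotent_pt w := beta_mul w w = w.

Definition left_ideal (L : set (beta G)) :=
  L !=set0 /\ forall a w, L w -> L (beta_mul a w).

Definition minimal_left_ideal (L : set (beta G)) :=
  left_ideal L /\ forall L', left_ideal L' -> L' `<=` L -> L' = L.

Definition minimal_idempotent w :=
  idempotent_pt w /\ minimal_left_ideal (range (beta_mul ^~ w)).

End beta_semigroup.

Section uniqueness_set.
Context {R : realType} {G : zmodType}.

(* The state s_w of the diagonal algebra, read on l^oo. *)
Definition pure_state (w : beta G) (f : linfty R G) : R[i] :=
  beta_ext (linfty_fun f) w.

Definition extends_pure_state (w : beta G) (s : bop R G -> R[i]) :=
  forall f : linfty R G, s (mulop f) = pure_state w f.

Definition uniqueness_set (w : beta G) : set (bop R G) :=
  [set X | forall s, is_state s -> extends_pure_state w s ->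
    s X = pure_state w (E0 X)].

End uniqueness_set.

(* Main.v *)
Require Import Defs.
From HB Require Import structures.
From mathcomp Require Import all_boot all_order all_algebra finmap complex.
From mathcomp Require Import all_classical all_reals all_analysis.
From mathcomp Require Import showcase.summability.
From mathcomp Require Import ring lra.

(** Let Y be X minus its diagonal.  Both directions of the argument go through
a description of uniqueness sets ([uniqueness_setP]): X lies in the uniqueness
set of w if and only if, for every e > 0, some A in the ultrafilter w has the
property that Y, compressed to the vectors supported in A, has numerical
radius at most e ([compression_le]).  If no such A existed for some e, each A
in w would carry a unit vector x_A on which Y has a quadratic form larger than
e; a limit of the vector states of the x_A along an ultrafilter that refines w
is then a state that extends the pure state of w and does not vanish at Y.
Conversely, if Y is small on A, then a self-adjoint part Z of Y satisfies
-V <= Z <= V with V = 2 e + K Q, where Q is the diagonal projection off A and K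
a constant; a state that extends the pure state of w vanishes at Q, so it is
at most 2 e at Z.

An element of VN(G) commutes with all translations since G is abelian
([VN_translation]).  Hence its diagonal is constant, Y commutes with the
translations too, and the family of the sets on which Y is e-small is
translation invariant ([compression_le_translation]).  It is also of finite
character: a set S belongs to it as soon as the finite subsets of S do, because
finitely supported vectors are dense ([compression_le_finite]).

Now let w be a minimal idempotent with X in its uniqueness set and let A in w
be e-small.  Put S = {k | A - k in w}.  For a finite subset F of S the
intersection of the A - k, k in F, lies in w, so it contains some h, which means
that F + h is contained in A; hence F, and therefore S, is e-small.  Minimality
of the left ideal of w makes S syndetic, in the form that every ultrafilter
contains a translate of S ([minimal_idempotent_return]).  Translates of S are
e-small, so every point of the compactification satisfies the criterion. *)

Set Implicit Arguments.
Unset Strict Implicit.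
Unset Printing Implicit Defensive.
Import Order.TTheory GRing.Theory Num.Theory.
Import numFieldNormedType.Exports.
Import Normc.

Local Open Scope classical_set_scope.
Local Open Scope ring_scope.

(** * Products of ultrafilters and return sets *)

Section beta_semigroup_theory.
Context {G : zmodType}.
Implicit Types (w a b : beta G) (A S : set G).

(** The basic sets A^* are clopen, so a limit along w lies in A^* exactly when
w-almost all the values do. *)
Lemma beta_ext_baseE (f : G -> beta G) w A :
  beta_base A (beta_ext f w) <-> beta_filter w [set g | beta_base A (f g)].
Proof.
have cf : f @ beta_filter w --> beta_ext f w.
  by apply: beta_compact_cvg; exact: beta_compact.
have near_lim B : beta_base B (beta_ext f w) ->
    beta_filter w [set g | beta_base B (f g)].
  move=> wB; apply: cf; apply: open_nbhs_nbhs.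
  by split=> //; exact: beta_base_open.
split=> [/near_lim//|fA].
have [//|/near_lim nfA] := beta_ultraC (beta_ext f w) A.
have [g [/= gA gnA]] := @filter_ex _ (beta_filter w) _ _ (filterI fA nfA).
by have [h []] := @filter_ex _ (beta_filter (f g)) _ _ (filterI gA gnA).
Qed.

(** The usual formula for the product: A is in a.w when the shifts A - g
belong to w for a-almost every g. *)
Lemma beta_mulE a w A : beta_filter (beta_mul a w) A <->
  beta_filter a [set g | beta_filter w [set h | A (g + h)]].
Proof.
rewrite -[beta_filter (beta_mul a w) A]/(beta_base A (beta_ext _ a)).
rewrite beta_ext_baseE.
suff -> : [set g | beta_base A (beta_act g w)] =
  [set g | beta_filter w [set h | A (g + h)]] by [].
apply/seteqP; split=> g /=; rewrite /beta_act beta_ext_baseE;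
  by apply: filterS => h; rewrite /= /beta_base /= principal_filterP.
Qed.

Lemma beta_mulA a b w : beta_mul (beta_mul a b) w = beta_mul a (beta_mul b w).
Proof.
apply/beta_inj/seteqP; split=> A; rewrite !beta_mulE; apply: filterS => g /=;
  rewrite beta_mulE; apply: filterS => h /=; apply: filterS => k /=;
  by rewrite addrA.
Qed.

(** This is the syndeticity of S = {k | A - k in w}.  By minimality
the left ideal generated by a.w is the whole left ideal of w, so b.(a.w) = w for
some b; then A is in b.(a.w), and any g in the corresponding set of b makes a
contain {k | g + k in S}. *)
Lemma minimal_idempotent_return w A a : minimal_idempotent w ->
  beta_filter w A ->
  exists g, beta_filter a [set k | beta_filter w [set h | A (g + k + h)]].
Proof.
move=> [idw [_ minw]] wA.
pose L' := range (beta_mul ^~ (beta_mul a w)).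
have L'E : L' = range (beta_mul ^~ w).
  apply: minw; last first.
    by move=> _ [b _ <-]; exists (beta_mul b a) => //; rewrite beta_mulA.
  split; first by exists (beta_mul a (beta_mul a w)); exists a.
  by move=> c _ [b _ <-]; exists (beta_mul c b) => //; rewrite beta_mulA.
have [b _ bw] : L' w by rewrite L'E; exists w.
move: wA; rewrite -{1}bw beta_mulE => bA.
have [g /= /beta_mulE ag] := @filter_ex _ (beta_filter b) _ _ bA.
exists g; apply: filterS ag => k /= wk.
by apply: filterS wk => h /=; rewrite addrA.
Qed.

End beta_semigroup_theory.

(** * The inner product of l^2 *)

#[local] Existing Instance summability.totally_filter.

Section inner_product.
Context {R : realType} {T : choiceType}.
Local Notation H := (ell2 R T).
Implicit Types (x y z : H) (t : T).

Lemma normcR (z : R[i]) : `|z| = (normc z)%:C%C.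
Proof. by case: z. Qed.

Lemma normc_real (r : R) : normc (r%:C)%C = `|r|.
Proof. by rewrite /= expr0n addr0 sqrtr_sqr. Qed.

Lemma partial_sumE (f : T -> R[i]) (A : {fset T}) :
  partial_sum f A = \sum_(t <- A) f t.
Proof. by rewrite big_seq_fsetE. Qed.

Lemma fsum_sqr_le x (A : {fset T}) :
  \sum_(t <- A) normc (x t) ^+ 2 <= norm2 x ^+ 2.
Proof.
rewrite -lee_fin sqr_norm2; apply: ereal_sup_ubound.
exists [set` A]; first by split=> //; exact: finite_fset.
by rewrite fsbig_finite ?set_fsetK ?sumEFin//; exact: finite_fset.
Qed.

Lemma fsum_sqr_adherent x (e : R) : 0 < e -> exists A : {fset T},
  norm2 x ^+ 2 - e < \sum_(t <- A) normc (x t) ^+ 2.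
Proof.
move=> e0.
have [_ [A [finA _] <-]] := ub_ereal_sup_adherent e0 (sqsum_fin x).
rewrite -/(esum _ _) -/(sqsum x) -sqr_norm2 fsbig_finite// sumEFin -EFinB.
by rewrite lte_fin => xA; exists (fset_set A).
Qed.

(** The norm is defined as a supremum of finite sums, the inner product as a
limit along finite sets; the two agree because the terms are nonnegative. *)
Lemma partial_sum_sqr_cvg x :
  partial_sum (fun t => `|x t| ^+ 2) @ totally --> (norm2 x ^+ 2)%:C%C.
Proof.
apply/cvgrPdist_lt => /= e e0.
have [r er] : exists r : R, e = r%:C%C.
  by exists (complex.Re e); rewrite RRe_real// gtr0_real.
rewrite er in e0 *; rewrite ltcR in e0.
have [A xA] := fsum_sqr_adherent x e0.
exists A => // B /= AB; rewrite partial_sumE.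
have -> : \sum_(t <- B) `|x t| ^+ 2 = (\sum_(t <- B) normc (x t) ^+ 2)%:C%C.
  by rewrite rmorph_sum; apply: eq_bigr => t _; rewrite normcR rmorphXn.
rewrite -rmorphB normcR ltcR normc_real ger0_norm ?subr_ge0 ?fsum_sqr_le// ltrBlDr -ltrBlDl (lt_le_trans xA)//.
have := @big_fset_incl _ _ +%R _ A B (fun t => if t \in A then normc (x t) ^+ 2 else 0) AB.
move=> E; rewrite big_seq (eq_bigr (fun t => if t \in A then normc (x t) ^+ 2 else 0)).
  rewrite -big_seq E; last by move=> t _ /negbTE ->.
  by apply: ler_sum => t _; case: ifP => // _; exact: sqr_ge0.
by move=> t ->.
Qed.

Definition nsq x : R[i] := (norm2 x ^+ 2)%:C%C.

Lemma mulC_polarization (a b : R[i]) : a * b^* =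
  4^-1 * (`|a + b| ^+ 2 - `|a - b| ^+ 2 + 'i * `|a + 'i * b| ^+ 2
          - 'i * `|a - 'i * b| ^+ 2).
Proof.
rewrite !normCK !rmorphD !rmorphN !rmorphM/= conjCi.
by field: (sqrCi R[i]).
Qed.

(** Polarization reduces the convergence of the series of x t * (y t)^* to
that of four series of squares, whose sums are the square norms of four vectors
of l^2. *)
Lemma polarization_cvg x y :
  partial_sum (fun t => x t * (y t)^*) @ totally -->
  4^-1 * (nsq (x + y) - nsq (x - y) + 'i * nsq (x + 'i *: y)
          - 'i * nsq (x - 'i *: y)).
Proof.
pose S z := partial_sum (fun t => `|z t| ^+ 2 : R[i]).
have -> : partial_sum (fun t => x t * (y t)^*) =
  fun A => 4^-1 * (S (x + y) A - S (x - y) A + 'i * S (x + 'i *: y) A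
          - 'i * S (x - 'i *: y) A).
  apply/funext => A; rewrite /S !partial_sumE !mulr_sumr -!sumrN -!big_split/=.
  rewrite mulr_sumr; apply: eq_bigr => t _.
  exact: mulC_polarization.
apply: cvgMr; apply: cvgB; last by apply: cvgMr; exact: partial_sum_sqr_cvg.
apply: cvgD; last by apply: cvgMr; exact: partial_sum_sqr_cvg.
by apply: cvgB; exact: partial_sum_sqr_cvg.
Qed.

Lemma inner_polarization x y : inner x y =
  4^-1 * (nsq (x + y) - nsq (x - y) + 'i * nsq (x + 'i *: y)
          - 'i * nsq (x - 'i *: y)).
Proof. by apply/cvg_lim; [exact: norm_hausdorff|exact: polarization_cvg]. Qed.

Lemma inner_cvg x y :
  partial_sum (fun t => x t * (y t)^*) @ totally --> inner x y.
Proof. by rewrite inner_polarization; exact: polarization_cvg. Qed.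

Lemma inner_linear (a : R[i]) x y z :
  inner (a *: x + y) z = a * inner x z + inner y z.
Proof.
apply/cvg_lim; first exact: norm_hausdorff.
have -> : partial_sum (fun t => (a *: x + y : H) t * (z t)^*) =
  fun A => a * partial_sum (fun t => x t * (z t)^*) A +
           partial_sum (fun t => y t * (z t)^*) A.
  apply/funext => A; rewrite !partial_sumE mulr_sumr -big_split/=.
  apply: eq_bigr => t _; transitivity ((a * x t + y t) * (z t)^*) => //.
  by rewrite mulrDl mulrA.
by apply: cvgD; [apply: cvgMr|]; exact: inner_cvg.
Qed.

Lemma innerJ x y : (inner x y)^* = inner y x.
Proof.
apply/esym/cvg_lim; first exact: norm_hausdorff.
have /cvgrPdist_le xy := @inner_cvg x y.
apply/cvgrPdist_le => e /xy; apply: filterS => A.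
suff -> : partial_sum (fun t => y t * (x t)^*) A =
    (partial_sum (fun t => x t * (y t)^*) A)^*.
  by rewrite -rmorphB norm_conjC.
rewrite !partial_sumE rmorph_sum; apply: eq_bigr => t _.
by rewrite rmorphM/= conjCK mulrC.
Qed.

Lemma inner_sqr x : inner x x = nsq x.
Proof.
have e : partial_sum (fun t => x t * (x t)^*) =
    partial_sum (fun t => `|x t| ^+ 2).
  by congr partial_sum; apply/funext => t; rewrite normCK.
apply/cvg_lim; first exact: norm_hausdorff.
by rewrite e; exact: partial_sum_sqr_cvg.
Qed.

Lemma innerDl x y z : inner (x + y) z = inner x z + inner y z.
Proof. by have := inner_linear 1 x y z; rewrite scale1r mul1r. Qed.

Lemma inner0l x : inner 0 x = 0.
Proof. by apply: (addrI (inner 0 x)); rewrite -innerDl !addr0. Qed.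

Lemma innerZl a x y : inner (a *: x) y = a * inner x y.
Proof. by rewrite -[a *: x]addr0 inner_linear inner0l addr0. Qed.

Lemma innerNl x y : inner (- x) y = - inner x y.
Proof. by rewrite -scaleN1r innerZl mulN1r. Qed.

Lemma innerDr x y z : inner x (y + z) = inner x y + inner x z.
Proof. by rewrite -innerJ innerDl rmorphD/= !innerJ. Qed.

Lemma innerZr a x y : inner x (a *: y) = a^* * inner x y.
Proof. by rewrite -innerJ innerZl rmorphM/= innerJ. Qed.

Lemma innerNr x y : inner x (- y) = - inner x y.
Proof. by rewrite -innerJ innerNl rmorphN/= innerJ. Qed.

Lemma innerBl x y z : inner (x - y) z = inner x z - inner y z.
Proof. by rewrite innerDl innerNl. Qed.

Lemma innerBr x y z : inner x (y - z) = inner x y - inner x z.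
Proof. by rewrite innerDr innerNr. Qed.

Lemma norm2_eq0 x : norm2 x = 0 -> x = 0.
Proof.
move=> x0; apply/val_inj/funext => t; apply: eq0_normc.
by apply/eqP; rewrite eq_le normc_ge0 -x0 normc_le_norm2.
Qed.

(** Expanding the square norm of <y,y> x - <x,y> y avoids dividing by the norm
of y. *)
Lemma cauchy_schwarz x y : normc (inner x y) <= norm2 x * norm2 y.
Proof.
have [y0|y0] := eqVneq (norm2 y) 0.
  rewrite (norm2_eq0 y0) -(scale0r 0) innerZr conjC0 mul0r normc0.
  by rewrite mulr_ge0 ?norm2_ge0.
set p := inner x y.
have E : nsq (nsq y *: x - p *: y) = nsq y * (nsq y * nsq x - p * p^*).
  rewrite -inner_sqr !(innerBl, innerBr, innerZl, innerZr) !inner_sqr.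
  rewrite -(innerJ x y) -/p (_ : (nsq y)^* = nsq y); last exact: conjc_real.
  by ring.
have : 0 <= nsq (nsq y *: x - p *: y) by rewrite ler0c sqr_ge0.
rewrite E.
rewrite -normCK normcR /nsq -!rmorphXn -!rmorphM -rmorphB -rmorphM ler0c.
rewrite pmulr_rge0; last by rewrite exprn_gt0// lt_neqAle eq_sym y0 norm2_ge0.
rewrite subr_ge0 -exprMn mulrC ler_sqr ?nnegrE ?normc_ge0//.
by rewrite mulr_ge0 ?norm2_ge0.
Qed.

End inner_product.

(** * Diagonal projections, density of finite supports, adjoints *)

Section diagonal_projections.
Context {R : realType} {T : choiceType}.
Local Notation H := (ell2 R T).
Implicit Types (x y z : H) (t : T) (A : set T).

Lemma inner_congr x y x' y' :
  (forall t, x t * (y t)^* = x' t * (y' t)^*) -> inner x y = inner x' y'.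
Proof. by move=> e; rewrite /inner; congr summability.sum; apply/funext. Qed.

Lemma indic_linfty_bounded A :
  exists M : R, forall t, normc ((t \in A)%:R : R[i]) <= M.
Proof.
by exists 1 => t; case: (t \in A); rewrite ?normc1 ?normc0.
Qed.

Definition indic_linfty A : linfty R T := Linfty (indic_linfty_bounded A).

(** The orthogonal projection onto the vectors supported in A. *)
Definition diag_proj A : bop R T := mulop (indic_linfty A).

Lemma proj_in A x t : A t -> diag_proj A x t = x t.
Proof. by move=> At; rewrite /= mem_set// mul1r. Qed.

Lemma proj_out A x t : ~ A t -> diag_proj A x t = 0.
Proof. by move=> At; rewrite /= memNset// mul0r. Qed.

Lemma projD A x : diag_proj A x + diag_proj (~` A) x = x.
Proof.
apply/val_inj/funext => t; rewrite -[LHS]/(diag_proj A x t + diag_proj (~` A) x t).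
have [At|At] := pselect (A t); first by rewrite proj_in// proj_out ?addr0//; exact.
by rewrite proj_out// proj_in ?add0r.
Qed.

Lemma inner_proj A x : inner (diag_proj A x) x = nsq (diag_proj A x).
Proof.
rewrite -inner_sqr; apply: inner_congr => t.
have [At|At] := pselect (A t); first by rewrite proj_in.
by rewrite proj_out// !mul0r.
Qed.

Lemma norm2_projD A x :
  norm2 (diag_proj A x) ^+ 2 + norm2 (diag_proj (~` A) x) ^+ 2 = norm2 x ^+ 2.
Proof.
apply: (@complexI R); rewrite rmorphD/= -!/(nsq _) -!inner_proj -innerDl projD.
exact: inner_sqr.
Qed.

Lemma norm2_proj_le A x : norm2 (diag_proj A x) <= norm2 x.
Proof.
rewrite -ler_sqr ?nnegrE ?norm2_ge0// -(norm2_projD A x) lerDl.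
exact: sqr_ge0.
Qed.

(** Norms are suprema of finite sums of squares, so some finite F carries
almost all of the square norm of x; the rest is what the projection off F
keeps. *)
Lemma finite_support_dense x (e : R) : 0 < e ->
  exists F : {fset T}, norm2 (diag_proj (~` [set` F]) x) < e.
Proof.
move=> e0; have [F xF] := fsum_sqr_adherent x (exprn_gt0 2 e0); exists F.
rewrite -ltr_sqr ?nnegrE ?norm2_ge0 ?(ltW e0)//.
have := fsum_sqr_le (diag_proj [set` F] x) F; have := norm2_projD [set` F] x.
have -> : \sum_(t <- F) normc (diag_proj [set` F] x t) ^+ 2 =
    \sum_(t <- F) normc (x t) ^+ 2.
  by rewrite big_seq [RHS]big_seq; apply: eq_bigr => t tF; rewrite proj_in.
by lra.
Qed.

Lemma ell2_sumE (I : Type) (r : seq I) (f : I -> H) t :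
  (\sum_(i <- r) f i : H) t = \sum_(i <- r) f i t.
Proof. by elim/big_rec2: _ => // i y z _ <-. Qed.

Lemma proj_fset (F : {fset T}) x :
  diag_proj [set` F] x = \sum_(t <- F) x t *: delta t.
Proof.
apply/val_inj/funext => u; rewrite [RHS]ell2_sumE.
have zE t : (x t *: delta t : H) u = x t * (u == t)%:R by [].
rewrite (eq_bigr _ (fun t _ => zE t)).
have [uF|uF] := pselect (u \in F).
  rewrite -[LHS]/(diag_proj [set` F] x u) proj_in// (big_fsetD1 u)//= eqxx mulr1.
  rewrite big_seq big1 ?addr0// => t; rewrite !inE eq_sym => /andP[/negbTE-> _].
  by rewrite mulr0.
rewrite -[LHS]/(diag_proj [set` F] x u) proj_out// big_seq big1// => t tF.
by case: eqP => [ut|]; rewrite ?mulr0//; case: uF; rewrite ut.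
Qed.

End diagonal_projections.

Lemma normcJ (R : realType) (z : R[i]) : normc z^* = normc z.
Proof. by case: z => a b; rewrite /= sqrrN. Qed.

Section adjoints.
Context {R : realType} {T : choiceType}.
Local Notation H := (ell2 R T).
Implicit Types (X Y : bop R T) (x y z : H) (t : T) (A : set T).

Lemma bop_linear X : linear X.
Proof. by have /asboolP[] := bop_funP X. Qed.

HB.instance Definition _ X :=
  GRing.isLinear.Build R[i] H H *:%R (bop_fun X) (bop_linear X).

Lemma bop_inner_le X : exists2 M : R, 0 <= M & forall x y,
  normc (inner (X x) y) <= M * norm2 x * norm2 y.
Proof.
have [M M0 XM] := bop_bound (bop_funP X); exists M => // x y.
by rewrite (le_trans (cauchy_schwarz _ _))// ler_wpM2r ?norm2_ge0.
Qed.

(** The basis vectors span the finitely supported vectors, which are dense. *)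
Lemma bounded_functional_eq0 (f : {scalar H}) (M : R) :
  (forall x, normc (f x) <= M * norm2 x) -> (forall t, f (delta t) = 0) ->
  forall x, f x = 0.
Proof.
move=> fM f0 x; apply: eq0_normc; apply/eqP; rewrite eq_le normc_ge0 andbT.
apply/ler_addgt0Pr => e e0; rewrite add0r.
have [F xF] := finite_support_dense x (divr_gt0 e0 (ltr_pwDr ltr01 (normr_ge0 M))).
rewrite -(projD [set` F] x) linearD proj_fset linear_sum/= big1 ?add0r; last first.
  by move=> t _; rewrite linearZ/= f0 mulr0.
rewrite (le_trans (fM _))// (@le_trans _ _ ((`|M| + 1) * norm2 (diag_proj (~` [set` F]) x)))//.
  by rewrite ler_wpM2r ?norm2_ge0// (le_trans (ler_norm M))// lerDl.
by rewrite mulrC -ler_pdivlMr ?(ltW xF)// ltr_pwDr.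
Qed.

(** The coordinates of the adjoint of X at y are forced: <X^* y, delta t> =
<y, X (delta t)>. *)
Definition adjoint_fun X y : T -> R[i] := fun t => inner y (X (delta t)).

(** Let c be the family of coordinates of the adjoint and z the sum of the
c t * delta t over a finite set F.  The sum s of the |c t|^2 over F equals both
|z|^2 and <X z, y>, so s <= M |z| |y| gives |z| <= M |y|. *)
Lemma adjoint_fun_sqsum X (M : R) : 0 <= M ->
  (forall x y, normc (inner (X x) y) <= M * norm2 x * norm2 y) ->
  forall y, (sqsum (adjoint_fun X y) <= (M ^+ 2)%:E * sqsum y)%E.
Proof.
move=> M0 XM y; apply: ge_ereal_sup => _ [A [finA _] <-].
rewrite fsbig_finite// sumEFin -sqr_norm2 -EFinM lee_fin.
set F := fset_set A; pose c := adjoint_fun X y.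
pose z : H := \sum_(t <- F) c t *: delta t.
set s : R := \sum_(t <- F) _.
have sE : (s%:C)%C = \sum_(t <- F) (c t)^* * c t.
  rewrite rmorph_sum; apply: eq_bigr => t _.
  by rewrite mulrC -normCK normcR rmorphXn.
have zs : s = norm2 z ^+ 2.
  apply: (@complexI R); rewrite -/(nsq z) -inner_sqr sE.
  have -> : inner z z = \sum_(t <- F) (c t)^* * inner z (delta t).
    rewrite -innerJ {1}/z (big_morph (inner^~ z) (fun x y => innerDl x y z) (inner0l z)).
    rewrite rmorph_sum; apply: eq_bigr => t _.
    by rewrite innerZl rmorphM/= innerJ.
  rewrite big_seq [RHS]big_seq; apply: eq_bigr => t tF; congr (_ * _).
  rewrite inner_delta ell2_sumE (big_fsetD1 t)//= big_seq big1 ?addr0.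
    by rewrite -[RHS]/(c t * (t == t)%:R) eqxx mulr1.
  move=> u; rewrite !inE eq_sym => /andP[/negbTE tu _].
  by rewrite -[LHS]/(c u * (t == u)%:R) tu mulr0.
have ys : (s%:C)%C = inner (X z) y.
  rewrite sE /z linear_sum/=.
  rewrite (big_morph (inner^~ y) (fun x z => innerDl x z y) (inner0l y)).
  by apply: eq_bigr => t _; rewrite linearZ/= innerZl mulrC -innerJ.
have : normc (s%:C)%C <= M * norm2 z * norm2 y by rewrite ys XM.
rewrite normc_real zs ger0_norm ?sqr_ge0//.
have [z0|z0] := eqVneq (norm2 z) 0.
  by move=> _; rewrite z0 expr0n -exprMn sqr_ge0.
rewrite {1}expr2 mulrAC ler_pM2r ?lt_neqAle ?norm2_ge0 1?eq_sym ?z0// => zM.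
by rewrite -exprMn ler_sqr ?nnegrE ?mulr_ge0 ?norm2_ge0.
Qed.

Lemma adjoint_exists X : exists Y, is_adjoint X Y.
Proof.
have [M M0 XM] := bop_inner_le X.
have sqY := adjoint_fun_sqsum M0 XM.
have Y_ell2 y : ell2_pred (adjoint_fun X y).
  apply/asboolP/(le_lt_trans (sqY y)).
  by apply: lte_mul_pinfty; rewrite ?lee_fin ?sqr_ge0 ?ell2P.
have Y_bop : bop_pred (fun y => Ell2 (Y_ell2 y)).
  apply/asboolP; split=> [a x y|]; last first.
    by exists M => y; apply: le_norm2 => //; exact: sqY.
  by apply/val_inj/funext => t; exact: inner_linear.
exists (Bop Y_bop) => x y; apply/eqP; rewrite -subr_eq0; apply/eqP; move: x.
have [N N0 YN] := bop_inner_le (Bop Y_bop).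
have lf : scalar (fun x => inner (X x) y - inner x (Bop Y_bop y)).
  by move=> a u v; rewrite linearP !inner_linear/=; ring.
pose f := GRing.isLinear.Build R[i] H R[i] *%R _ lf.
pose F : {scalar H} := HB.pack (fun x => inner (X x) y - inner x (Bop Y_bop y)) f.
apply: (@bounded_functional_eq0 F ((M + N) * norm2 y)) => [x|t] /=.
  have -> : (M + N) * norm2 y * norm2 x =
    M * norm2 x * norm2 y + N * norm2 y * norm2 x by ring.
  by rewrite (le_trans (le_normcD _ _))// normcN lerD// -innerJ normcJ YN.
by rewrite -(innerJ _ (delta t)) inner_delta /= /adjoint_fun innerJ subrr.
Qed.

End adjoints.

(** * Compressions and states *)

Section compressions.
Context {R : realType} {T : choiceType}.
Local Notation H := (ell2 R T).
Implicit Types (X Y Z : bop R T) (x y z : H) (t : T) (A B : set T) (e : R).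

(** The compression of Y to the vectors supported in A has numerical radius at
most e.  The numerical radius is used instead of the operator norm because a
vector state sees only the quadratic form of Y. *)
Definition compression_le Y e A := forall x, (forall t, ~ A t -> x t = 0) ->
  normc (inner (Y x) x) <= e * norm2 x ^+ 2.

Lemma compression_le_sub Y e A B :
  A `<=` B -> compression_le Y e B -> compression_le Y e A.
Proof. by move=> AB YB x xA; apply: YB => t Bt; apply: xA => /AB. Qed.

(** Cutting x down to A changes the quadratic form by at most a multiple of
the norm of the part of x off A. *)
Lemma quadratic_form_proj Y (M : R) A x : 0 <= M ->
  (forall x y, normc (inner (Y x) y) <= M * norm2 x * norm2 y) ->
  normc (inner (Y x) x) <= normc (inner (Y (diag_proj A x)) (diag_proj A x)) +
    2 * M * norm2 x * norm2 (diag_proj (~` A) x).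
Proof.
move=> M0 YM; set u := diag_proj A x; set v := diag_proj (~` A) x.
have xE : u + v = x := projD A x.
have -> : inner (Y x) x = inner (Y u) u + (inner (Y u) v + inner (Y v) x).
  by rewrite -{1}xE linearD/= innerDl addrA -innerDr xE.
rewrite (le_trans (le_normcD _ _))// lerD2l (le_trans (le_normcD _ _))//.
have uvle : normc (inner (Y u) v) <= M * norm2 x * norm2 v.
  by rewrite (le_trans (YM _ _))// ler_wpM2r ?norm2_ge0 ?ler_wpM2l ?norm2_proj_le.
by rewrite (le_trans (lerD uvle (YM v x)))//; lra.
Qed.

(** The quadratic form is continuous and finitely supported vectors are
dense. *)
Lemma compression_le_finite Y e S : 0 <= e ->
  (forall F : {fset T}, [set` F] `<=` S -> compression_le Y e [set` F]) ->
  compression_le Y e S.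
Proof.
move=> e0 YF x xS; apply/ler_addgt0Pr => d d0.
have [M M0 YM] := bop_inner_le Y.
have K0 : 0 < 2 * M * norm2 x + 1 by rewrite ltr_wpDl// !mulr_ge0 ?norm2_ge0.
have [F xF] := finite_support_dense x (divr_gt0 d0 K0).
rewrite (le_trans (quadratic_form_proj [set` F] x M0 YM))// lerD//; last first.
  rewrite (@le_trans _ _ ((2 * M * norm2 x + 1) * norm2 (diag_proj (~` [set` F]) x)))//.
    by rewrite ler_wpM2r ?norm2_ge0// lerDl.
  by rewrite mulrC -ler_pdivlMr// ltW.
rewrite (@le_trans _ _ (e * norm2 (diag_proj [set` F] x) ^+ 2))//; last first.
  by rewrite ler_wpM2l// ler_sqr ?nnegrE ?norm2_ge0 ?norm2_proj_le.
apply: (YF [fset t in F | `[< S t >]]%fset).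
  by move=> t /=; rewrite !inE => /andP[_ /asboolP].
move=> t tFS; have [tF|tF] := pselect ([set` F] t); last by rewrite proj_out.
rewrite proj_in// xS// => tS; apply: tFS; rewrite /= !inE.
by apply/andP; split; [exact: tF|exact/asboolP].
Qed.

End compressions.

Section states.
Context {R : realType} {T : choiceType}.
Local Notation H := (ell2 R T).
Implicit Types (X Y Z : bop R T) (x y z : H) (t : T) (A B : set T) (e : R).

Lemma bopDE X Y x : (X + Y : bop R T) x = X x + Y x. Proof. by []. Qed.
Lemma bopZE (a : R[i]) X x : (a *: X : bop R T) x = a *: X x. Proof. by []. Qed.

(** Off A the form of Z is bounded crudely by M |x| |v|, where v is the part of
x off A, and 2 M |x| |v| <= e |x|^2 + (M^2 / e) |v|^2.  Hence
2 e + (M^2 / e) Q - Z and 2 e + (M^2 / e) Q + Z are positive, where Q is the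
projection off A, and the state vanishes at Q. *)
Lemma state_selfadjoint_le (s : bop R T -> R[i]) Z e A : is_state s ->
  (forall x, complex.Im (inner (Z x) x) = 0) -> 0 < e ->
  s (diag_proj (~` A)) = 0 -> compression_le Z e A -> normc (s Z) <= 2 * e.
Proof.
move=> [lin_s pos_s s1] realZ e0 sA ZA.
have [M M0 ZM] := bop_inner_le Z.
pose K : R := M ^+ 2 / e.
have bound x : normc (inner (Z x) x) <=
    2 * e * norm2 x ^+ 2 + K * norm2 (diag_proj (~` A) x) ^+ 2.
  rewrite (le_trans (quadratic_form_proj A x M0 ZM))//.
  set u := diag_proj A x; set b := norm2 (diag_proj (~` A) x); set n := norm2 x.
  have ZAu : normc (inner (Z u) u) <= e * n ^+ 2.
    rewrite (@le_trans _ _ (e * norm2 u ^+ 2))//.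
      by apply: ZA => t At; rewrite proj_out.
    by rewrite ler_wpM2l ?(ltW e0)// ler_sqr ?nnegrE ?norm2_ge0 ?norm2_proj_le.
  pose q := M * b / e.
  have Mb : M * b = e * q by rewrite /q; field; rewrite gt_eqF.
  have -> : K * b ^+ 2 = e * q ^+ 2 by rewrite /K /q; field; rewrite gt_eqF.
  have -> : 2 * M * n * b = 2 * e * q * n.
    by rewrite -mulrA (mulrC n) mulrA -(mulrA 2) Mb mulrA.
  by have := mulr_ge0 (ltW e0) (sqr_ge0 (n - q)); lra.
have sign (c : R[i]) : complex.Im c = 0 -> normc c = 1 ->
    0 <= (2 * e)%:C%C - c * s Z.
  move=> c0 c1.
  pose V : bop R T := (- c) *: Z + ((2 * e)%:C%C *: opid + K%:C%C *: diag_proj (~` A)).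
  have : 0 <= s V.
    apply: pos_s => x; rewrite /V 2!bopDE 3!bopZE !innerDl !innerZl inner_proj.
    rewrite [inner (opid x) x]inner_sqr /nsq -!rmorphM -rmorphD/= lecE.
    have := bound x; have := realZ x; clear V; move: c0 c1.
    case: c => a b /= -> ; case: (inner _ _) => p q /= + ->.
    rewrite !expr0n !addr0 !sqrtr_sqr => a1 zx; rewrite oppr0 !(mul0r, mulr0, addr0, subr0) eqxx/=.
    rewrite mulNr addrC subr_ge0 (le_trans _ zx)//.
    by rewrite (le_trans (ler_norm _))// normrM a1 mul1r.
  rewrite /V lin_s lin_s -[_ *: diag_proj _]addr0 lin_s s1 sA.
  have -> : s 0 = 0 by have := lin_s (-1) 0 0; rewrite scaler0 addr0 mulN1r addNr.
  by rewrite !mulr0 !addr0 mulr1 mulNr addrC.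
have := sign 1 erefl (normc1 _); have := sign (-1) (oppr0 _).
rewrite normcN normc1 => /(_ erefl); rewrite mulN1r mul1r opprK.
case: (s Z) => a b; rewrite !lecE/= => /andP[/eqP b0 ha] /andP[_ hb].
have {}b0 : b = 0 by move: b0; rewrite !(mul0r, mulr0, add0r, addr0).
rewrite b0 expr0n addr0 sqrtr_sqr ler_norml.
by move: ha hb; lra.
Qed.

(** Positivity only controls operators with a real quadratic form, so Y is
split as 2 Y = Z1 - i Z2 with Z1 = Y + Y' and Z2 = i (Y - Y'), where Y' is the
adjoint of Y. *)
Lemma state_compression_le (s : bop R T -> R[i]) Y e A : is_state s ->
  0 < e -> s (diag_proj (~` A)) = 0 -> compression_le Y e A -> normc (s Y) <= 4 * e.
Proof.
move=> st e0 sA YA; have [lin_s _ _] := st.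
have [Y' adjY] := adjoint_exists Y.
have qY' x : inner (Y' x) x = (inner (Y x) x)^* by rewrite adjY innerJ.
have Y'A : compression_le Y' e A by move=> x xA; rewrite qY' normcJ YA.
pose Z1 : bop R T := Y + Y'; pose Z2 : bop R T := 'i *: (Y - Y').
have ImZ1 x : complex.Im (inner (Z1 x) x) = 0.
  rewrite bopDE innerDl qY'; case: (inner _ _) => a b /=; exact: subrr.
have bopNE X x : (- X : bop R T) x = - X x by [].
have ImZ2 x : complex.Im (inner (Z2 x) x) = 0.
  rewrite bopZE bopDE bopNE innerZl innerBl qY'; case: (inner _ _) => a b /=.
  by rewrite mul0r mul1r add0r subrr.
have Z1A : compression_le Z1 (2 * e) A.
  move=> x xA; rewrite bopDE innerDl (le_trans (le_normcD _ _))//.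
  by rewrite (le_trans (lerD (YA x xA) (Y'A x xA)))//; lra.
have normci : normc ('i : R[i]) = 1 by rewrite /= expr0n add0r expr1n sqrtr1.
have Z2A : compression_le Z2 (2 * e) A.
  move=> x xA; rewrite bopZE bopDE bopNE innerZl innerBl normcM normci mul1r.
  rewrite (le_trans (le_normcD _ _))// normcN.
  by rewrite (le_trans (lerD (YA x xA) (Y'A x xA)))//; lra.
have e20 : 0 < 2 * e by rewrite mulr_gt0.
have s1 := state_selfadjoint_le st ImZ1 e20 sA Z1A.
have s2 := state_selfadjoint_le st ImZ2 e20 sA Z2A.
have sE : 2 * s Y = s Z1 - 'i * s Z2.
  have -> : s Z1 - 'i * s Z2 = s (- 'i *: Z2 + Z1) by rewrite lin_s mulNr addrC.
  have -> : - 'i *: Z2 + Z1 = 2 *: Y + 0.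
    rewrite /Z2 scalerA mulNr -expr2 sqrCi opprK scale1r addr0 /Z1.
    by rewrite addrACA [- _ + _]addrC subrr addr0 -mulr2n scaler_nat.
  rewrite lin_s (_ : s 0 = 0) ?addr0//.
  by have := lin_s (-1) 0 0; rewrite scaler0 addr0 mulN1r addNr.
have : 2 * normc (s Y) <= 2 * (4 * e).
  have -> : 2 * normc (s Y) = normc (2 * s Y) by rewrite !mulr_natl normcMn.
  rewrite sE (le_trans (le_normcD _ _))// normcN normcM normci mul1r.
  by rewrite (le_trans (lerD s1 s2))//; lra.
by lra.
Qed.

End states.

(** * Uniqueness sets through small compressions *)

Section uniqueness.
Context {R : realType} {G : zmodType}.
Local Notation H := (ell2 R G).
Implicit Types (X Y Z : bop R G) (x y z : H) (w : beta G) (A : set G).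

Definition offdiag X : bop R G := X - mulop (E0 X).

Lemma state_offdiag (s : bop R G -> R[i]) w X : is_state s ->
  extends_pure_state w s -> s X = s (offdiag X) + pure_state w (E0 X).
Proof.
move=> [lin_s _ _] sw.
have -> : offdiag X = -1 *: mulop (E0 X) + X by rewrite scaleN1r addrC.
by rewrite lin_s sw mulN1r addrAC addNr add0r.
Qed.

(** A state that extends the pure state of w vanishes at the projection off any
A in w. *)
Lemma uniqueness_set_compression_le w X :
  (forall e : R, 0 < e ->
    exists2 A, beta_filter w A & compression_le (offdiag X) e A) ->
  uniqueness_set w X.
Proof.
move=> YA s st sw; rewrite (state_offdiag _ st sw).
suff -> : s (offdiag X) = 0 by rewrite add0r.
apply: eq0_normc; apply/eqP; rewrite eq_le normc_ge0 andbT.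
apply/ler_addgt0Pr => e e0; rewrite add0r.
have e40 : 0 < e / 4 by rewrite divr_gt0.
have [A wA YAe] := YA _ e40.
rewrite (le_trans (state_compression_le st e40 _ YAe))//; last first.
  by rewrite mulrC divfK.
rewrite sw; apply/cvg_lim; first exact: norm_hausdorff.
apply: cvg_near_cst; apply: filterS wA => t At /=.
by rewrite memNset//; exact.
Qed.

Lemma linfty_cvgP (T : Type) (v : beta T) (f : linfty R T) :
  linfty_fun f @ beta_filter v --> beta_ext (linfty_fun f) v.
Proof. exact: linfty_cvg. Qed.

Section vector_states.
Variables (x_ : set G -> H) (v : beta (set G)).
Hypothesis x_unit : forall A, norm2 (x_ A) = 1.

Lemma vector_state_bounded Z :
  exists M : R, forall A, normc (inner (Z (x_ A)) (x_ A)) <= M.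
Proof.
have [M M0 ZM] := bop_inner_le Z; exists M => A.
by rewrite (le_trans (ZM _ _))// x_unit !mulr1.
Qed.

Definition vector_state_fun Z : linfty R (set G) :=
  Linfty (vector_state_bounded Z).

(** The limit along v of the vector states of the unit vectors x_ A.  The
vectors are indexed by the subsets of G, so v is an ultrafilter on the power
set. *)
Definition vector_state_lim Z : R[i] := beta_ext (linfty_fun (vector_state_fun Z)) v.

Lemma vector_state_lim_cvg Z :
  (fun A => inner (Z (x_ A)) (x_ A)) @ beta_filter v --> vector_state_lim Z.
Proof. exact: linfty_cvgP. Qed.

Lemma vector_state_lim_state : is_state vector_state_lim.
Proof.
split=> [a X Y|X posX|].
- apply/cvg_lim; first exact: norm_hausdorff.
  have -> : linfty_fun (vector_state_fun (a *: X + Y)) =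
      fun A => a * inner (X (x_ A)) (x_ A) + inner (Y (x_ A)) (x_ A).
    by apply/funext => A; rewrite /= -inner_linear.
  by apply: cvgD; [apply: cvgMr|]; exact: vector_state_lim_cvg.
- have cX := @vector_state_lim_cvg X.
  have nX : (fun A => inner (X (x_ A)) (x_ A)) =
      (fun A => `|inner (X (x_ A)) (x_ A)|).
    by apply/funext => A; rewrite ger0_norm.
  suff -> : vector_state_lim X = `|vector_state_lim X| by exact: normr_ge0.
  apply: (cvg_unique _ cX (y := `|vector_state_lim X|)); first exact: norm_hausdorff.
  by rewrite nX; exact: cvg_norm cX.
- apply/cvg_lim; first exact: norm_hausdorff.
  apply: cvg_near_cst; apply: nearW => A /=.
  by rewrite [LHS]inner_sqr /nsq x_unit expr1n.
Qed.

(** If the x_ B are eventually supported in each A of w, then multiplication by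
f acts on them eventually as the scalar f(w), up to e. *)
Lemma vector_state_lim_extends w :
  (forall A, beta_filter w A -> beta_filter v
    [set B | forall t, ~ A t -> x_ B t = 0]) ->
  extends_pure_state w vector_state_lim.
Proof.
move=> vw f; apply/cvg_lim; first exact: norm_hausdorff.
have /cvgrPdist_le fw := @linfty_cvgP _ w f; rewrite -/(pure_state w f) in fw *.
set l := pure_state w f in fw *.
apply/cvgrPdist_le => e e0; have := fw e e0.
have [r er] : exists r : R, e = r%:C%C.
  by exists (complex.Re e); rewrite RRe_real// gtr0_real.
rewrite {e}er in e0 *; rewrite ltcR in e0.
move=> /vw; apply: filterS => A xA /=.
have -> : l = inner (l *: x_ A) (x_ A).
  by rewrite innerZl inner_sqr /nsq x_unit expr1n mulr1.
rewrite -innerBl normcR lecR (le_trans (cauchy_schwarz _ _))// x_unit mulr1.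
rewrite -[r]mulr1 -(x_unit A); apply: le_norm2; first exact: ltW.
apply: le_sqsumZ => [|t]; first exact: ltW.
rewrite -[_ t]/(l * x_ A t - f t * x_ A t) -mulrBl normcM.
have [tr|tr] := pselect (`|l - f t| <= r%:C%C); last first.
  by rewrite xA// normc0 !mulr0.
by rewrite ler_wpM2r ?normc_ge0// -lecR -normcR.
Qed.

End vector_states.

Lemma unit_vector Y (e : R) A : ~ compression_le Y e A ->
  exists x, [/\ norm2 x = 1, forall t, ~ A t -> x t = 0 &
                e < normc (inner (Y x) x)].
Proof.
move=> /existsNP[x /not_implyP[xA /negP]]; rewrite -ltNge => xe.
have x0 : norm2 x != 0.
  apply: contraTneq xe => x0; rewrite x0 expr0n/= mulr0 -leNgt.
  by rewrite (norm2_eq0 x0) linear0 inner0l normc0.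
pose c : R := (norm2 x)^-1.
have c0 : 0 < c by rewrite invr_gt0 lt_neqAle eq_sym x0 norm2_ge0.
have qE z : inner (c%:C%C *: z) (c%:C%C *: x) = (c ^+ 2)%:C%C * inner z x.
  rewrite innerZl innerZr (_ : (c%:C%C)^* = c%:C%C); last exact: conjc_real.
  by rewrite mulrA -rmorphM.
exists (c%:C%C *: x); split.
- have : nsq (c%:C%C *: x) = 1.
    by rewrite -inner_sqr qE inner_sqr -rmorphM -exprMn mulVf// expr1n.
  move=> /complexI/eqP; by rewrite sqrp_eq1 ?norm2_ge0// => /eqP.
- by move=> t At; rewrite -[LHS]/(c%:C%C * x t) xA// mulr0.
- rewrite linearZ/= qE normcM normc_real.
  rewrite ger0_norm ?sqr_ge0// mulrC -ltr_pdivrMr ?exprn_gt0//.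
  by rewrite -exprVn invrK.
Qed.

(** Were Y not e-small on any A in w, there would be unit vectors x_A supported
in A with |<Y x_A, x_A>| > e.  Along an ultrafilter that contains the
sets {B in w | B contained in A} for all A in w, their vector states converge to
an extension of the pure state of w that is at least e in modulus at Y. *)
Lemma compression_le_uniqueness_set w X : uniqueness_set w X ->
  forall e : R, 0 < e ->
    exists2 A, beta_filter w A & compression_le (offdiag X) e A.
Proof.
move=> wX e e0; apply: contrapT => noA.
have /choice[x_ x_P] : forall A, exists x : H, norm2 x = 1 /\
    (beta_filter w A -> (forall t, ~ A t -> x t = 0) /\
      e < normc (inner (offdiag X x) x)).
  move=> A; have [wA|wA] := pselect (beta_filter w A).
    have [|x [x1 xA xe]] := @unit_vector (offdiag X) e A.
      by move=> YA; apply: noA; exists A.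
    by exists x.
  (* Sets outside w form a null set of the limit; any unit vector will do. *)
  by exists (delta 0); split=> //; rewrite /norm2 sqsum_delta sqrtr1.
pose F := filter_from (beta_filter w) (fun A => [set B | B `<=` A /\ beta_filter w B]).
have PF : ProperFilter F.
  apply: filter_from_proper; last by move=> A wA; exists A; split.
  apply: filter_from_filter; first by exists setT; exact: filterT.
  move=> A B wA wB; exists (A `&` B); first exact: filterI.
  by move=> C []; rewrite subsetI => -[CA CB] wC.
have [V [UV FV]] := ultraFilterLemma PF.
pose v := Beta UV.
have x1 A : norm2 (x_ A) = 1 by have [] := x_P A.
have vw : extends_pure_state w (vector_state_lim v x1).
  apply: vector_state_lim_extends => A wA; apply: FV; exists A => // B [BA wB] t At.
  by have [_ /(_ wB)[xB _]] := x_P B; apply: xB => /BA.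
have st := vector_state_lim_state v x1.
have Y0 : vector_state_lim v x1 (offdiag X) = 0.
  apply: (addIr (pure_state w (E0 X))).
  by rewrite add0r -(state_offdiag _ st vw) (wX _ st vw).
have := @vector_state_lim_cvg x_ v x1 (offdiag X); rewrite Y0.
move=> /cvgrPdist_lt/(_ e%:C%C); rewrite ltcR => /(_ e0) small.
have large : V [set A | e < normc (inner (offdiag X (x_ A)) (x_ A))].
  apply: FV; exists setT; first exact: filterT.
  by move=> A [_ wA]; have [_ /(_ wA)[]] := x_P A.
have [A [/= eA Ae]] := @filter_ex _ V _ _ (filterI large small).
by move: Ae; rewrite sub0r normrN normcR ltcR ltNge (ltW eA).
Qed.

Lemma uniqueness_setP w X : uniqueness_set w X <->
  forall e : R, 0 < e ->
    exists2 A, beta_filter w A & compression_le (offdiag X) e A.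
Proof.
by split; [exact: compression_le_uniqueness_set|exact: uniqueness_set_compression_le].
Qed.

End uniqueness.

(** * Operators that commute with the translations *)

Section translation_invariance.
Context {R : realType} {G : zmodType}.
Local Notation H := (ell2 R G).
Implicit Types (X Y Z : bop R G) (x y z : H) (w : beta G) (A : set G).

Definition translation_commutant : set (bop R G) :=
  [set X | forall g x, X (translation g x) = translation g (X x)].

Lemma nsq_translation g x : nsq (translation g x) = nsq x.
Proof. by rewrite /nsq /norm2 translate_sqsum. Qed.

Lemma inner_translation g x y :
  inner (translation g x) (translation g y) = inner x y.
Proof.
rewrite !inner_polarization -!linearZ -!linearB -!linearD.
by rewrite !nsq_translation.
Qed.

Lemma translationK g x : translation g (translation (- g) x) = x.
Proof. by apply/val_inj/funext => t; rewrite /= opprK subrK. Qed.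

(** Closure under adjoints uses that translations are unitary; weak closure
holds because commuting is an equality between matrix coefficients. *)
Lemma translation_commutant_vna : von_neumann_algebra translation_commutant.
Proof.
split=> //.
- move=> a X Y XC YC g x.
  rewrite -[LHS]/(a *: X (translation g x) + Y (translation g x)) XC YC.
  by rewrite -linearP.
- by move=> X Y XC YC g x; rewrite /= YC XC.
- move=> X Y XC XY g x; apply/val_inj/funext => t.
  rewrite -[LHS]inner_delta -[RHS]inner_delta -innerJ -[RHS]innerJ; congr (_^*).
  rewrite -XY -[delta t in LHS](translationK g) XC inner_translation XY.
  by rewrite -(inner_translation g) translationK.
- pose m : bop R G -> {ptws H * H -> R[i]} := matrix_coefs.
  pose E g x t := [set X : initial_topology m |
    m X (translation g x, delta t) = m X (x, delta (t - g))].
  have -> : translation_commutant = \bigcap_g \bigcap_x \bigcap_t E g x t.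
    apply/seteqP; split=> X /=.
      by move=> XC g _ x _ t _; rewrite /E /= /m /matrix_coefs/= XC !inner_delta.
    move=> XC g x; apply/val_inj/funext => t.
    by have := XC g I x I t I; rewrite /E /= /m /matrix_coefs/= !inner_delta.
  apply: closed_bigI => g _; apply: closed_bigI => x _; apply: closed_bigI => t _.
  have cm p : continuous ((fun X => m X p) : initial_topology m -> R[i]).
    move=> X; apply: (@continuous_comp (initial_topology m) {ptws H * H -> R[i]} R[i]
      m (@proj _ (fun _ => R[i]) p)); first exact: initial_continuous.
    exact: proj_continuous.
  rewrite /E; set p := (_, _); set q := (x, _).
  have -> : [set X : initial_topology m | m X p = m X q] =
      (fun X : initial_topology m => m X p - m X q) @^-1` [set 0].
    apply/seteqP; split=> X /=; first by move=> ->; rewrite subrr.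
    by move/eqP; rewrite subr_eq0 => /eqP.
  apply: preimage_closed.
    by move=> X _; apply: continuousB; exact: cm.
  exact/accessible_closed_set1/hausdorff_accessible/norm_hausdorff.
Qed.

Lemma VN_translation X : VN R G X -> translation_commutant X.
Proof.
apply; split; first exact: translation_commutant_vna.
move=> _ [g _ <-] h x; apply/val_inj/funext => t /=.
by rewrite addrAC.
Qed.

(** A translation invariant operator has a constant diagonal, so its diagonal
part is a scalar operator. *)
Lemma offdiag_commutant X :
  translation_commutant X -> translation_commutant (offdiag X).
Proof.
move=> XC g x.
have diagE t : E0 X t = E0 X 0.
  rewrite /= -[t in LHS]addr0 -translation_delta XC; exact: inner_translation.
transitivity (X (translation g x) - mulop (E0 X) (translation g x)) => //.
transitivity (translation g (X x - mulop (E0 X) x)) => //.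
rewrite linearB XC; congr (_ - _).
by apply/val_inj/funext => t; rewrite -[LHS]/(E0 X t * x (t - g))
  -[RHS]/(E0 X (t - g) * x (t - g)) !diagE.
Qed.

Lemma compression_le_translation Y (e : R) A g : translation_commutant Y ->
  compression_le Y e A -> compression_le Y e [set h | A (h + g)].
Proof.
move=> YC YA x xA.
have := YA (translation g x); rewrite YC inner_translation.
have -> : norm2 (translation g x) = norm2 x by rewrite /norm2 translate_sqsum.
by apply=> t At; apply: xA; rewrite /= subrK.
Qed.

End translation_invariance.

(** * Transfer from one minimal idempotent to all ultrafilters *)

Theorem theorem16 (R : realType) (G : zmodType) (hG : countable [set: G]%classic)
    (X : bop R G) (hX : VN R G X) :
  (exists w : beta G, minimal_idempotent w /\ uniqueness_set w X) ->
  forall a : beta G, uniqueness_set a X.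
Proof.
move=> [w [minw /uniqueness_setP wX]] a; apply/uniqueness_setP => e e0.
have YC := offdiag_commutant (VN_translation hX).
have [A wA YA] := wX e e0.
pose S := [set k | beta_filter w [set h | A (k + h)]].
have YS : compression_le (offdiag X) e S.
  apply: compression_le_finite => [|F FS]; first exact: ltW.
  (* A point h of this intersection has F + h contained in A. *)
  have : beta_filter w (\bigcap_(k in [set` F]) [set h | A (k + h)]).
    exact: filter_bigI.
  move=> /(@filter_ex _ (beta_filter w))[h Fh].
  apply: (compression_le_sub _ (compression_le_translation YC YA)) => k kF.
  exact: Fh.
have [g ag] := minimal_idempotent_return a minw wA.
exists [set k | S (k + g)]; last exact: compression_le_translation.
by apply: filterS ag => k; rewrite /= addrC.
Qed.
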